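(* For $\lambda\vdash 2n$, the $H_n^B(0)$-module $\mathbb C\mathsf{SDT}(\lambda)$ satisfies $\mathrm{ch}^B(\mathbb C\mathsf{SDT}(\lambda))=G_\lambda$, where $G_\lambda=\sum_{T\in\mathsf{SDT}(\lambda)}F^B_{\mathrm{Des}(T)}$.
   Context: $H_n^B(0)$ is the $\mathbb C$-algebra generated by $\pi_0,\dots,\pi_{n-1}$ with relations $\pi_i^2=-\pi_i$, $\pi_i\pi_j=\pi_j\pi_i$ for $|i-j|\ge 2$, $\pi_i\pi_{i+1}\pi_i=\pi_{i+1}\pi_i\pi_{i+1}$ for $1\le i\le n-2$, and $\pi_0\pi_1\pi_0\pi_1=\pi_1\pi_0\pi_1\pi_0$. A standard domino tableau of shape $\lambda$ is a bijective filling with $[n]$ of the dominoes of a tiling of the Young diagram of $\lambda$ by $1\times2$ and $2\times1$ dominoes, with entries increasing left to right along rows and top to bottom in columns; $\mathsf{SDT}(\lambda)$ is their set. $\mathrm{dom}_i(T)$ is the domino with entry $i$. $i\in[0,n-1]$ is a descent of $T$ if $i=0$ and $\mathrm{dom}_1(T)$ is vertical, or $i>0$ and $\mathrm{dom}_{i+1}(T)$ is strictly lower than $\mathrm{dom}_i(T)$ (in rows strictly below all rows of $\mathrm{dom}_i(T)$); $\mathrm{Des}(T)$ is the descent set. For $1\le i\le n-1$, $s_i(T)$ exchanges entries $i,i+1$; if $\mathrm{dom}_1(T),\mathrm{dom}_2(T)$ tile the northwest-most $2\times 2$ square, $s_0(T)$ switches the orientation of both (placing $1$ left of $2$ if $1$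 was above $2$, and $1$ above $2$ if $1$ was left of $2$), otherwise $s_0(T)$ is regarded as not in $\mathsf{SDT}(\lambda)$. The module structure on $\mathbb C\mathsf{SDT}(\lambda)$: $\pi_i(T)=-T$ if $i\in\mathrm{Des}(T)$, $\pi_i(T)=s_i(T)$ if $i\notin\mathrm{Des}(T)$ and $s_i(T)\in\mathsf{SDT}(\lambda)$, and $\pi_i(T)=0$ otherwise. For $I\subseteq[0,n-1]$, $\mathcal S_I^B=\mathbb C\varepsilon_I$ is the one-dimensional module with $\pi_j\varepsilon_I=-\varepsilon_I$ if $j\in I$ and $0$ otherwise. $F^B_I=\sum x_{i_1}\cdots x_{i_n}$ over integers $0=i_0\le i_1\le\cdots\le i_n$ with $i_j<i_{j+1}$ whenever $j\in I$. $\mathrm{ch}^B$ is the additive map from the Grothendieck group of finite-dimensional $H_n^B(0)$-modules (relations from short exact sequences) with $\mathrm{ch}^B([\mathcal S_I^B])=F^B_I$. *)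

(* Defs.v *)
From HB Require Import structures.
From mathcomp Require Import all_boot all_order all_algebra ring_quotient perm.
From mathcomp.finmap Require Import finmap.
From mathcomp.classical Require Import boolp classical_sets functions fsbigop.
From mathcomp.reals Require Import reals.
From mathcomp.real_closed Require Import complex.
From mathcomp.multinomials Require Import freeg monalg.

Set Implicit Arguments.
Unset Strict Implicit.
Unset Printing Implicit Defensive.

Import GRing.Theory passmx.
Local Open Scope ring_scope.
Local Open Scope quotient_scope.

(* The 0-Hecke algebra H_n^B(0) over K (in the theorem K is the field of complex
   numbers): the free algebra on pi_0, ..., pi_(n-1), modulo the two-sided ideal
   generated by the differences of both sides of the defining relations. *)
Section HeckeAlgebra.
Variables (K : fieldType) (n : nat).

Local Notation free_alg := {malg K[{fmonom 'I_n}]}.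

Definition free_gen (i : 'I_n) : free_alg := << fmu i >>.

Inductive hecke_rel : free_alg -> Prop :=
| HeckeQuadratic i :
    hecke_rel (free_gen i * free_gen i - - free_gen i)
| HeckeCommute (i j : 'I_n) : (i.+1 < j)%N || (j.+1 < i)%N ->
    hecke_rel (free_gen i * free_gen j - free_gen j * free_gen i)
| HeckeBraid3 (i j : 'I_n) : (0 < i)%N -> j = i.+1 :> nat ->
    hecke_rel (free_gen i * free_gen j * free_gen i
               - free_gen j * free_gen i * free_gen j)
| HeckeBraid4 (i j : 'I_n) : i = 0%N :> nat -> j = 1%N :> nat ->
    hecke_rel (free_gen i * free_gen j * free_gen i * free_gen j
               - free_gen j * free_gen i * free_gen j * free_gen i).

Definition two_sided_ideal (S : free_alg -> Prop) :=
  [/\ S 0, forall x y, S x -> S y -> S (x - y)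
    & forall a x b, S x -> S (a * x * b)].

Definition hecke_ideal : pred free_alg := fun x =>
  `[< forall S, two_sided_ideal S -> (forall r, hecke_rel r -> S r) -> S x >].

Lemma hecke_idealP : two_sided_ideal hecke_ideal.
Proof.
split=> [|x y /asboolP Sx /asboolP Sy|a x b /asboolP Sx].
- by apply/asboolP => S [].
- apply/asboolP => S iS rS; case: (iS) => _ + _; apply.
    exact: Sx.
  exact: Sy.
- apply/asboolP => S iS rS; case: (iS) => _ _; apply; exact: Sx.
Qed.

Lemma hecke_ideal_zmod_closed : zmod_closed hecke_ideal.
Proof. by case: hecke_idealP => J0 JB _; split=> // x y; apply: JB. Qed.

HB.instance Definition _ :=
  GRing.isZmodClosed.Build free_alg hecke_ideal hecke_ideal_zmod_closed.

Definition heckeB := {ideal_quot (GRing.ZmodClosed.clone _ hecke_ideal _)}.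
HB.instance Definition _ := GRing.Zmodule.on heckeB.
HB.instance Definition _ := Quotient.on heckeB.

Definition hecke_pi (x : free_alg) : heckeB := \pi_(heckeB) x.
Definition hecke_gen (i : 'I_n) : heckeB := hecke_pi (free_gen i).

Lemma hecke_piK (h : heckeB) : hecke_pi (repr h) = h.
Proof. exact: reprK. Qed.

Lemma hecke_pi_eq x y : hecke_pi x = hecke_pi y <-> x - y \in hecke_ideal.
Proof.
rewrite /hecke_pi; split => [e|e].
  by rewrite Quotient.idealrBE; apply/eqP.
by apply/eqP; rewrite -Quotient.idealrBE.
Qed.

Lemma hecke_piB : {morph hecke_pi : x y / x - y}.
Proof. by move=> x y; rewrite /hecke_pi !piE. Qed.

HB.instance Definition _ :=
  GRing.isZmodMorphism.Build free_alg heckeB hecke_pi hecke_piB.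

Definition hecke_one : heckeB := hecke_pi 1.
Definition hecke_mul (g h : heckeB) : heckeB := hecke_pi (repr g * repr h).
Definition hecke_scale (a : K) (h : heckeB) : heckeB := hecke_pi (a *: repr h).

Lemma hecke_repr_pi x : repr (hecke_pi x) - x \in hecke_ideal.
Proof. by apply/hecke_pi_eq; rewrite hecke_piK. Qed.

Lemma hecke_mulE x y : hecke_mul (hecke_pi x) (hecke_pi y) = hecke_pi (x * y).
Proof.
apply/hecke_pi_eq; set x' := repr _; set y' := repr _.
have -> : x' * y' - x * y = 1 * (x' - x) * y' - x * (y - y') * 1.
  by rewrite mul1r mulr1 mulrBl mulrBr opprB addrA subrK.
case: hecke_idealP => _ JB JM; apply: JB; apply: JM; first exact: hecke_repr_pi.
by rewrite -opprB; apply: (rpredNr (hecke_repr_pi y)).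
Qed.

Lemma hecke_scaleE a x : hecke_scale a (hecke_pi x) = hecke_pi (a *: x).
Proof.
apply/hecke_pi_eq; rewrite -scalerBr -[X in a *: X]mul1r scalerAl -[X in X \in _]mulr1.
by case: hecke_idealP => _ _; apply; exact: hecke_repr_pi.
Qed.

Lemma hecke_mulA : associative hecke_mul.
Proof.
move=> x y z; rewrite -[x]hecke_piK -[y]hecke_piK -[z]hecke_piK.
by rewrite !hecke_mulE mulrA.
Qed.

Lemma hecke_mul1 : left_id hecke_one hecke_mul.
Proof. by move=> x; rewrite -[x]hecke_piK hecke_mulE mul1r. Qed.

Lemma hecke_mulr1 : right_id hecke_one hecke_mul.
Proof. by move=> x; rewrite -[x]hecke_piK hecke_mulE mulr1. Qed.

Lemma hecke_mulDl : left_distributive hecke_mul +%R.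
Proof.
move=> x y z; rewrite -[x]hecke_piK -[y]hecke_piK -[z]hecke_piK.
by rewrite -raddfD !hecke_mulE mulrDl raddfD.
Qed.

Lemma hecke_mulDr : right_distributive hecke_mul +%R.
Proof.
move=> x y z; rewrite -[x]hecke_piK -[y]hecke_piK -[z]hecke_piK.
by rewrite -raddfD !hecke_mulE mulrDr raddfD.
Qed.

(* The augmentation sending every generator to 0 separates 1 from 0. *)
Lemma hecke_one_neq0 : hecke_one != 0.
Proof.
have [aug [augB augM aug1 aug_gen]] : exists aug : free_alg -> K,
    [/\ {morph aug : x y / x - y}, {morph aug : x y / x * y}, aug 1 = 1
      & forall i, aug (free_gen i) = 0].
  exists (mcoeff mone); split=> [x y|x y||i].
  - exact: raddfB.
  - exact: rmorphM.
  - exact: rmorph1.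
  - rewrite mcoeffU; case: eqP => // /(congr1 (@fmonom_val _)).
    by rewrite fm1 fmuE.
have aug0 : aug 0 = 0 by rewrite -(subrr (0 : free_alg)) augB subrr.
apply/eqP => e1; have : (1 : free_alg) - 0 \in hecke_ideal.
  by apply/hecke_pi_eq; rewrite raddf0.
rewrite subr0 => /asboolP/(_ (fun x => aug x = 0)) H.
suff : aug 1 = 0 by move/eqP; rewrite aug1 oner_eq0.
apply: H => [|r].
  split=> [//|x y x0 y0|a x b x0]; first by rewrite augB x0 y0 subrr.
  by rewrite !augM x0 mulr0 mul0r.
have augB0 x y : aug x = 0 -> aug y = 0 -> aug (x - y) = 0.
  by move=> x0 y0; rewrite augB x0 y0 subrr.
have augM0 x y : aug y = 0 -> aug (x * y) = 0.
  by move=> y0; rewrite augM y0 mulr0.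
case=> [i|i j _|i j _ _|i j _ _]; apply: (augB0); try exact: augM0.
by rewrite -[- free_gen i]sub0r; apply: augB0.
Qed.

HB.instance Definition _ := GRing.Zmodule_isNzRing.Build heckeB
  hecke_mulA hecke_mul1 hecke_mulr1 hecke_mulDl hecke_mulDr hecke_one_neq0.

Lemma hecke_scaleA a b h :
  hecke_scale a (hecke_scale b h) = hecke_scale (a * b) h.
Proof. by rewrite -[h]hecke_piK !hecke_scaleE scalerA. Qed.

Lemma hecke_scale1 : left_id 1 hecke_scale.
Proof. by move=> h; rewrite -[h]hecke_piK hecke_scaleE scale1r. Qed.

Lemma hecke_scaleDr : right_distributive hecke_scale +%R.
Proof.
move=> a x y; rewrite -[x]hecke_piK -[y]hecke_piK.
by rewrite -raddfD !hecke_scaleE scalerDr raddfD.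
Qed.

Lemma hecke_scaleDl h : {morph hecke_scale^~ h : a b / a + b}.
Proof.
by move=> a b; rewrite -[h]hecke_piK !hecke_scaleE scalerDl raddfD.
Qed.

HB.instance Definition _ := GRing.Zmodule_isLmodule.Build K heckeB
  hecke_scaleA hecke_scale1 hecke_scaleDr hecke_scaleDl.

Lemma hecke_piD x y : hecke_pi (x + y) = hecke_pi x + hecke_pi y.
Proof. exact: raddfD. Qed.

Lemma hecke_piZ a x : hecke_pi (a *: x) = a *: hecke_pi x.
Proof. exact: esym (hecke_scaleE a x). Qed.

Lemma hecke_scaleAl (a : K) (g h : heckeB) : a *: (g * h) = (a *: g) * h.
Proof.
rewrite -[g]hecke_piK -[h]hecke_piK /GRing.scale /GRing.mul /=.
by rewrite !(hecke_scaleE, hecke_mulE) scalerAl.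
Qed.

HB.instance Definition _ := GRing.Lmodule_isLalgebra.Build K heckeB hecke_scaleAl.

Lemma free_scaleAr (a : K) (x y : free_alg) : a *: (x * y) = x * (a *: y).
Proof.
rewrite (malgMEw (fsubset_refl (msupp x)) (msuppZ_le a y)) malgME scaler_sumr.
apply: eq_bigr => u _; rewrite scaler_sumr; apply: eq_bigr => v _.
rewrite mcoeffZ mulrCA; set b := _ * mcoeff v y; set w := mmul u v.
by apply/malgP => k; rewrite mcoeffZ [X in a * X]mcoeffU [RHS]mcoeffU mulrnAr.
Qed.

Lemma hecke_scaleAr (a : K) (g h : heckeB) : a *: (g * h) = g * (a *: h).
Proof.
rewrite -[g]hecke_piK -[h]hecke_piK /GRing.scale /GRing.mul /=.
by rewrite !(hecke_scaleE, hecke_mulE) free_scaleAr.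
Qed.

HB.instance Definition _ := GRing.Lalgebra_isAlgebra.Build K heckeB hecke_scaleAr.

End HeckeAlgebra.

Section Modules.
Variables (K : fieldType) (n : nat).

Record hmod := Hmod {
  hmod_space :> vectType K;
  hact : {linear heckeB K n -> 'End(hmod_space)};
  hact1 : hact 1 = \1%VF;
  hactM : forall g h, hact (g * h) = (hact g \o hact h)%VF
}.

Definition hecke_equivariant (A B : hmod) (f : 'Hom(A, B)) :=
  forall (h : heckeB K n) (v : A), f (hact A h v) = hact B h (f v).

Definition short_exact (A B C : hmod) :=
  exists (f : 'Hom(A, B)) (g : 'Hom(B, C)),
    [/\ hecke_equivariant f, hecke_equivariant g,
        lker f = 0%VS, limg f = lker g & limg g = fullv].

Definition to_coord (V : vectType K) : 'Hom(V, 'rV[K]_(\dim {:V})) :=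
  linfun (rVof (vbasis {:V})).
Definition of_coord (V : vectType K) : 'Hom('rV[K]_(\dim {:V}), V) :=
  linfun (vecof (vbasis {:V})).

Lemma to_coordE (V : vectType K) v : to_coord V v = rVof (vbasis {:V}) v.
Proof. exact: lfunE. Qed.

Lemma of_coordE (V : vectType K) v :
  of_coord V v = vecof (vbasis {:V}) v.
Proof. exact: lfunE. Qed.

Lemma to_coordK (V : vectType K) : cancel (to_coord V) (of_coord V).
Proof.
by move=> v; rewrite to_coordE of_coordE rVofK ?vbasisP.
Qed.

Lemma of_coordK (V : vectType K) : cancel (of_coord V) (to_coord V).
Proof.
by move=> v; rewrite to_coordE of_coordE vecofK ?vbasisP.
Qed.

(* Universe constraints of the library prevent hmod from being an eqType, hence
   from being a set of generators of a free abelian group. The modules carried by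
   the spaces K^d do form such a type, and represent all isomorphism classes:
   coord_rep transports a module along an isomorphism A ~ K^(dim A). *)
Record hrep := Hrep {
  rep_dim : nat;
  rep_act : heckeB K n -> 'End('rV[K]_rep_dim);
  rep_act_linear : linear rep_act;
  rep_act1 : rep_act 1 = \1%VF;
  rep_actM : forall g h, rep_act (g * h) = (rep_act g \o rep_act h)%VF
}.

HB.instance Definition _ := gen_eqMixin hrep.
HB.instance Definition _ := gen_choiceMixin hrep.

HB.instance Definition _ (r : hrep) :=
  GRing.isLinear.Build K (heckeB K n) 'End('rV[K]_(rep_dim r)) *:%R (rep_act r)
    (rep_act_linear r).

Coercion rep_module (r : hrep) : hmod :=
  @Hmod 'rV[K]_(rep_dim r) (rep_act r) (rep_act1 r) (@rep_actM r).

Section CoordRep.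
Variable A : hmod.

Definition coord_act (h : heckeB K n) : 'End('rV[K]_(\dim {:A})) :=
  (to_coord A \o hact A h \o of_coord A)%VF.

Lemma coord_act_linear : linear coord_act.
Proof.
move=> a g h; rewrite /coord_act linearP /= comp_lfunDr comp_lfunDl.
by rewrite -comp_lfunZr -comp_lfunZl.
Qed.

Lemma coord_act1 : coord_act 1 = \1%VF.
Proof. by rewrite /coord_act hact1 comp_lfun1r; apply/lfunP => v; rewrite comp_lfunE of_coordK id_lfunE. Qed.

Lemma coord_actM g h : coord_act (g * h) = (coord_act g \o coord_act h)%VF.
Proof.
by apply/lfunP => v; rewrite /coord_act hactM !comp_lfunE to_coordK.
Qed.

Definition coord_rep : hrep := Hrep coord_act_linear coord_act1 coord_actM.

End CoordRep.

(* The Grothendieck group: the free abelian group on the modules, modulo the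
   subgroup generated by [B] - [A] - [C] for 0 -> A -> B -> C -> 0 exact.
   Isomorphic modules have the same class, as seen on 0 -> A -> B -> 0 -> 0. *)
Local Notation free_group := {freeg hrep / int}.

Definition free_class (r : hrep) : free_group := [freeg [:: (1, r)]].

Definition exact_relations : pred free_group := fun x =>
  `[< forall S : free_group -> Prop,
        S 0 -> (forall u v, S u -> S v -> S (u - v)) ->
        (forall A B C : hrep, short_exact A B C ->
           S (free_class B - free_class A - free_class C)) ->
        S x >].

Lemma exact_relations_zmod_closed : zmod_closed exact_relations.
Proof.
split=> [|x y /asboolP Sx /asboolP Sy]; first by apply/asboolP.
by apply/asboolP => S S0 SB SE; apply: (SB); [exact: Sx | exact: Sy].
Qed.

HB.instance Definition _ := GRing.isZmodClosed.Build free_group exact_relations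
  exact_relations_zmod_closed.

Definition groth := {ideal_quot (GRing.ZmodClosed.clone _ exact_relations _)}.
HB.instance Definition _ := GRing.Zmodule.on groth.
HB.instance Definition _ := Quotient.on groth.

Definition groth_class (A : hmod) : groth := \pi_groth (free_class (coord_rep A)).

Lemma coord_rep_exact (A B C : hmod) : short_exact A B C ->
  short_exact (coord_rep A) (coord_rep B) (coord_rep C).
Proof.
move=> [f [g [ef eg kf fg ig]]].
have actE (D : hmod) h v :
    hact (coord_rep D) h v = to_coord D (hact D h (of_coord D v)).
  by rewrite /= /coord_act !comp_lfunE.
have cE (D E : hmod) (u : 'Hom(D, E)) v :
    (to_coord E \o u \o of_coord D)%VF v =
    to_coord E (u (of_coord D v)).
  by rewrite !comp_lfunE.
exists (to_coord B \o f \o of_coord A)%VF, (to_coord C \o g \o of_coord B)%VF.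
split.
- by move=> h v; rewrite cE !actE (@to_coordK _) ef cE (@to_coordK _).
- by move=> h v; rewrite cE !actE (@to_coordK _) eg cE (@to_coordK _).
- apply/eqP/lker0P => u v; rewrite !cE => /(can_inj (@to_coordK _)) /eqP.
  move/eqP: kf => /lker0P kf /eqP /kf; exact: (can_inj (@of_coordK _)).
- apply/vspaceP => v; apply/idP/idP.
    move/memv_imgP => [u _ ->]; rewrite memv_ker !cE (@to_coordK _).
    have : f (of_coord A u) \in lker g by rewrite -fg memv_img ?memvf.
    by rewrite memv_ker => /eqP ->; rewrite linear0.
  rewrite memv_ker cE => /eqP e.
  have : of_coord B v \in lker g.
    by rewrite memv_ker; apply/eqP/(can_inj (@to_coordK _)); rewrite e linear0.
  rewrite -fg => /memv_imgP[u _ e']; apply/memv_imgP; exists (to_coord _ u).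
    exact: memvf.
  by rewrite cE (@to_coordK _) -e' (@of_coordK _).
- apply/vspaceP => v; rewrite memvf; apply/memv_imgP.
  have : of_coord C v \in limg g by rewrite ig memvf.
  move=> /memv_imgP[u _ e]; exists (to_coord _ u); first exact: memvf.
  by rewrite cE (@to_coordK _) -e (@of_coordK _).
Qed.

Lemma groth_class_exact (A B C : hmod) : short_exact A B C ->
  groth_class B = groth_class A + groth_class C.
Proof.
move=> /coord_rep_exact ex; apply/eqP; rewrite /groth_class.
rewrite -[_ + _](raddfD (\pi_groth)) -Quotient.idealrBE.
by apply/asboolP => S _ _ SE; rewrite opprD addrA; apply: SE.
Qed.

Fact zero_act_linear : linear (fun _ : heckeB K n => 0 : 'End('rV[K]_0)).
Proof. by move=> a g h; rewrite scaler0 addr0. Qed.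

Fact zero_act1 : 0 = \1%VF :> 'End('rV[K]_0).
Proof. by apply/lfunP => v; rewrite [LHS]thinmx0 [RHS]thinmx0. Qed.

Fact zero_actM (g h : heckeB K n) : 0 = ((0 : 'End('rV[K]_0)) \o 0)%VF :> 'End('rV[K]_0).
Proof. by rewrite comp_lfun0l. Qed.

Definition zero_rep : hrep := Hrep zero_act_linear zero_act1 zero_actM.

Lemma exact_iso (A B : hmod) (f : 'Hom(A, B)) : hecke_equivariant f ->
  lker f = 0%VS -> limg f = fullv -> short_exact A B zero_rep.
Proof.
move=> ef kf imf; exists f, 0; split=> //.
- by move=> h v; rewrite [LHS]thinmx0 [RHS]thinmx0.
- apply/vspaceP => v; rewrite imf memvf memv_ker; apply/esym/eqP.
  by rewrite [LHS]thinmx0 [RHS]thinmx0.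
- apply/vspaceP => v; rewrite memvf; apply/memv_imgP; exists 0.
    exact: memvf.
  by rewrite linear0 [LHS]thinmx0.
Qed.

Lemma groth_class_rep (r : hrep) : groth_class r = \pi_groth (free_class r).
Proof.
have iso : short_exact r (coord_rep r) zero_rep.
  apply: (@exact_iso r (coord_rep r) (to_coord r)).
  - by move=> h v; rewrite /= /coord_act !comp_lfunE to_coordK.
  - by apply/eqP/lker0P => u v; apply: (can_inj (@to_coordK r)).
  - apply/vspaceP => v; rewrite memvf; apply/memv_imgP.
    by exists (of_coord r v); [apply: memvf | rewrite of_coordK].
have zero : short_exact zero_rep zero_rep zero_rep.
  apply: (@exact_iso zero_rep zero_rep \1%VF) => [h v||].
  - by rewrite !id_lfunE.
  - by apply/eqP/lker0P => u v; rewrite !id_lfunE.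
  - exact: lim1g.
apply/eqP; rewrite /groth_class -Quotient.idealrBE.
apply/asboolP => S S0 SB SE.
have SZ : S (free_class zero_rep).
  have SN : S (0 - free_class zero_rep).
    by rewrite -{1}(subrr (free_class zero_rep)); apply: SE zero.
  by rewrite -[free_class _]opprK -[- - _]sub0r -[- free_class _]sub0r; apply: SB.
have SN : S (0 - free_class zero_rep) by apply: SB.
have -> : free_class (coord_rep r) - free_class r =
    (free_class (coord_rep r) - free_class r - free_class zero_rep)
    - (0 - free_class zero_rep).
  by rewrite sub0r opprK subrK.
by apply: SB => //; apply: SE.
Qed.

(* Operators satisfying the defining relations extend to a unique module
   structure. *)
Section FromGenerators.
Variables (V : vectType K) (f : 'I_n -> 'End(V)).

Definition hecke_ops := [/\
  forall i, (f i \o f i)%VF = - f i,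
  forall i j : 'I_n, (i.+1 < j)%N || (j.+1 < i)%N ->
    (f i \o f j = f j \o f i)%VF,
  forall i j : 'I_n, (0 < i)%N -> j = i.+1 :> nat ->
    (f i \o f j \o f i = f j \o f i \o f j)%VF
& forall i j : 'I_n, i = 0%N :> nat -> j = 1%N :> nat ->
    (f i \o f j \o f i \o f j = f j \o f i \o f j \o f i)%VF].

Definition word_op (w : {fmonom 'I_n}) : 'End(V) :=
  foldr (fun i u => (f i \o u)%VF) \1%VF (w : seq 'I_n).

Definition eval_ops (x : {malg K[{fmonom 'I_n}]}) : 'End(V) :=
  \sum_(w <- msupp x) mcoeff w x *: word_op w.

Lemma eval_opsEw (d : {fset {fmonom 'I_n}}) x : (msupp x `<=` d)%fset ->
  eval_ops x = \sum_(w <- d) mcoeff w x *: word_op w.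
Proof.
move=> le; rewrite /eval_ops (big_fset_incl _ le) //= => w _ /mcoeff_outdom ->.
by rewrite scale0r.
Qed.

Lemma eval_ops_is_linear : linear eval_ops.
Proof.
move=> a x y; pose d := (msupp (a *: x + y) `|` (msupp x `|` msupp y))%fset.
have s1 : (msupp (a *: x + y) `<=` d)%fset by apply: fsubsetUl.
have s2 : (msupp x `<=` d)%fset.
  by apply: fsubset_trans (fsubsetUr _ _); apply: fsubsetUl.
have s3 : (msupp y `<=` d)%fset.
  by apply: fsubset_trans (fsubsetUr _ _); apply: fsubsetUr.
rewrite (eval_opsEw s1) (eval_opsEw s2) (eval_opsEw s3) scaler_sumr -big_split.
by apply: eq_bigr => w _ /=; rewrite mcoeffD mcoeffZ scalerDl scalerA.
Qed.

HB.instance Definition _ := GRing.isLinear.Build K {malg K[{fmonom 'I_n}]}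
  'End(V) *:%R eval_ops eval_ops_is_linear.

Lemma eval_opsU c w : eval_ops << c *g w >> = c *: word_op w.
Proof. by rewrite (eval_opsEw msuppU_le) big_seq_fset1 mcoeffUU. Qed.

Lemma word_opM (u v : {fmonom 'I_n}) :
  word_op (mmul u v) = (word_op u \o word_op v)%VF.
Proof.
rewrite /word_op fmM foldr_cat; elim: (u : seq _) => [|i s IH] /=.
  by rewrite comp_lfun1l.
by rewrite IH comp_lfunA.
Qed.

Lemma eval_opsE x v :
  eval_ops x v = \sum_(w <- msupp x) mcoeff w x *: word_op w v.
Proof.
by rewrite /eval_ops sum_lfunE; apply: eq_bigr => w _; rewrite scale_lfunE.
Qed.

Lemma eval_opsM x y : eval_ops (x * y) = (eval_ops x \o eval_ops y)%VF.
Proof.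
apply/lfunP => v; rewrite comp_lfunE (eval_opsE x) malgME raddf_sum sum_lfunE.
apply: eq_bigr => u _; rewrite raddf_sum sum_lfunE eval_opsE linear_sum /=.
rewrite scaler_sumr; apply: eq_bigr => w _.
by rewrite eval_opsU word_opM scale_lfunE comp_lfunE linearZ /= scalerA.
Qed.

Lemma eval_ops1 : eval_ops 1 = \1%VF.
Proof. by rewrite (eval_opsU 1 mone) scale1r /word_op fm1. Qed.

Lemma eval_ops_gen i : eval_ops (free_gen K i) = f i.
Proof. by rewrite eval_opsU scale1r /word_op fmuE /= comp_lfun1r. Qed.

Hypothesis f_ops : hecke_ops.

Lemma eval_ops_ideal x : x \in @hecke_ideal K n -> eval_ops x = 0.
Proof.
have evB y z : eval_ops y = eval_ops z -> eval_ops (y - z) = 0.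
  by move=> e; rewrite raddfB /= e subrr.
have evM y z := eval_opsM y z; have gen := eval_ops_gen.
have evMM y z a b : eval_ops y = a -> eval_ops z = b ->
    eval_ops (y * z) = (a \o b)%VF by move=> <- <-; apply: evM.
move/asboolP/(_ (fun x => eval_ops x = 0)); apply.
  split=> [|y z y0 z0|a y b y0]; first exact: raddf0.
    by apply: evB; rewrite y0 z0.
  by rewrite evM (evM a) y0 comp_lfun0r comp_lfun0l.
case: f_ops => q c b3 b4 r; case=> [i|i j ij|i j i0 ij|i j i0 j1]; apply: evB.
- by rewrite raddfN /= evM !eval_ops_gen q.
- apply: etrans (evMM _ _ _ _ (gen i) (gen j)) _; rewrite c //.
  exact: esym (evMM _ _ _ _ (gen j) (gen i)).
- have gij := evMM _ _ _ _ (gen i) (gen j).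
  have gji := evMM _ _ _ _ (gen j) (gen i).
  apply: etrans (evMM _ _ _ _ gij (gen i)) _; rewrite b3 //.
  exact: esym (evMM _ _ _ _ gji (gen j)).
- have giji := evMM _ _ _ _ (evMM _ _ _ _ (gen i) (gen j)) (gen i).
  have gjij := evMM _ _ _ _ (evMM _ _ _ _ (gen j) (gen i)) (gen j).
  apply: etrans (evMM _ _ _ _ giji (gen j)) _; rewrite b4 //.
  exact: esym (evMM _ _ _ _ gjij (gen i)).
Qed.

Definition ops_act (h : heckeB K n) : 'End(V) := eval_ops (repr h).

Lemma ops_act_pi x : ops_act (hecke_pi x) = eval_ops x.
Proof.
apply/eqP; rewrite -subr_eq0 -raddfB; apply/eqP.
exact: (eval_ops_ideal (hecke_repr_pi x)).
Qed.

Lemma ops_act_linear : linear ops_act.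
Proof.
move=> a g h; rewrite -[g]hecke_piK -[h]hecke_piK.
have -> : a *: hecke_pi (repr g) + hecke_pi (repr h)
        = hecke_pi (a *: repr g + repr h).
  by rewrite (hecke_piD (a *: repr g)) (hecke_piZ a (repr g)).
by rewrite !ops_act_pi linearP.
Qed.

HB.instance Definition _ := GRing.isLinear.Build K (heckeB K n) 'End(V) *:%R
  ops_act ops_act_linear.

Lemma ops_act1 : ops_act 1 = \1%VF.
Proof. by rewrite (ops_act_pi 1) eval_ops1. Qed.

Lemma ops_actM g h : ops_act (g * h) = (ops_act g \o ops_act h)%VF.
Proof. by rewrite -eval_opsM -ops_act_pi. Qed.

Definition module_of_ops : hmod := Hmod ops_act1 ops_actM.

Lemma module_of_opsE i v : hact module_of_ops (hecke_gen K i) v = f i v.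
Proof. by rewrite /= ops_act_pi eval_ops_gen. Qed.

End FromGenerators.
End Modules.

(* A domino (r, c, v): northwest cell in row r and column c (rows counted downwards,
   from 0), vertical iff v. All cells of a diagram of size 2n have coordinates
   below 2n. *)
Definition domino n := ('I_n.*2 * 'I_n.*2 * bool)%type.

Section Tableaux.
Variables (n : nat) (la : seq nat).
Implicit Types d : domino n.

Definition vertical d := d.2.

Definition cells d : seq (nat * nat) :=
  let: (r, c, v) := d in
  [:: (r : nat, c : nat); if v then (r.+1, c : nat) else (r : nat, c.+1)].

Definition in_diagram (x : nat * nat) := (x.2 < nth 0%N la x.1)%N.

(* Entries are shifted by one: T k is the domino with entry k + 1. *)
Definition is_sdt (T : {ffun 'I_n -> domino n}) : Prop :=
  [/\ forall k x, x \in cells (T k) -> in_diagram x,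
      forall x, in_diagram x -> exists! k, x \in cells (T k)
    & forall k l x y, x \in cells (T k) -> y \in cells (T l) ->
        (x.1 = y.1 /\ (x.2 <= y.2)%N) \/ (x.2 = y.2 /\ (x.1 <= y.1)%N) ->
        (k <= l)%N].

Record sdt := Sdt { sdt_val :> {ffun 'I_n -> domino n}; _ : `[< is_sdt sdt_val >] }.

HB.instance Definition _ := [isSub for sdt_val].
HB.instance Definition _ := [Finite of sdt by <:].

(* In terms of entries, T i is the domino dom_(i+1)(T), and for i > 0 the ordinal
   ord_pred i is i - 1, so that T (ord_pred i) is dom_i(T). *)
Definition is_descent (T : {ffun 'I_n -> domino n}) (i : 'I_n) : bool :=
  if i == 0%N :> nat then vertical (T i)
  else all (fun x => all (fun y => x.1 < y.1)%N (cells (T i)))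
           (cells (T (ord_pred i))).

Definition Des (T : sdt) : {set 'I_n} := [set i | is_descent T i].

(* Switching the orientation of both dominoes of a tiling of the northwest-most
   2 x 2 square is reflecting them in the main diagonal: this exchanges
   "1 above 2" (both horizontal) and "1 left of 2" (both vertical). *)
Definition reflect_domino d : domino n := let: (r, c, v) := d in (c, r, ~~ v).

Definition switch_first (T : {ffun 'I_n -> domino n}) : {ffun 'I_n -> domino n} :=
  [ffun k : 'I_n => if (k < 2)%N then reflect_domino (T k) else T k].

(* For i = 0, T i and T (ordS i) are dom_1(T) and dom_2(T). (If n = 1 then
   ordS i = i, and the test fails as it should.) *)
Definition tile_northwest (T : {ffun 'I_n -> domino n}) (i : 'I_n) : bool :=
  perm_eq (cells (T i) ++ cells (T (ordS i))) [:: (0, 0); (0, 1); (1, 0); (1, 1)]%N.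

Definition sdt_s (i : 'I_n) (T : sdt) : option sdt :=
  if i == 0%N :> nat then
    if tile_northwest T i then insub (switch_first T) else None
  else insub [ffun k => T (tperm (ord_pred i) i k)].

End Tableaux.

Section SdtModule.
Variables (K : fieldType) (n : nat) (la : seq nat).

Local Notation SDT := (sdt n la).

Definition sdt_space : vectType K := {ffun SDT -> K^o}.

Definition sdt_basis (T : SDT) : sdt_space := [ffun U => (U == T)%:R].

Definition sdt_pi (i : 'I_n) (T : SDT) : sdt_space :=
  if i \in Des T then - sdt_basis T
  else if sdt_s i T is Some U then sdt_basis U else 0.

Definition sdt_op_fun (i : 'I_n) (u : sdt_space) : sdt_space :=
  \sum_(T : SDT) (u : {ffun SDT -> K^o}) T *: sdt_pi i T.

Lemma sdt_op_fun_linear i : linear (sdt_op_fun i).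
Proof.
move=> a u v; rewrite /sdt_op_fun scaler_sumr -big_split; apply: eq_bigr => T _.
by rewrite !ffunE scalerDl scalerA.
Qed.

HB.instance Definition _ i := GRing.isLinear.Build K sdt_space sdt_space *:%R
  (sdt_op_fun i) (sdt_op_fun_linear i).

Definition sdt_op (i : 'I_n) : 'End(sdt_space) := linfun (sdt_op_fun i).

Lemma sdt_op_basis i T : sdt_op i (sdt_basis T) = sdt_pi i T.
Proof.
rewrite lfunE /= /sdt_op_fun (bigD1 T) //= ffunE eqxx scale1r big1 ?addr0 // => U.
by rewrite ffunE => /negPf ->; rewrite scale0r.
Qed.

End SdtModule.

Section SimpleModules.
Variables (K : fieldType) (n : nat) (I : {set 'I_n}).

Definition simple_op (i : 'I_n) : 'End(K^o) := if i \in I then - \1%VF else 0.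

Lemma simple_ops : hecke_ops simple_op.
Proof.
have cc i j : (simple_op i \o simple_op j)%VF =
    if (i \in I) && (j \in I) then \1%VF else 0.
  rewrite /simple_op; case: (i \in I); case: (j \in I) => /=;
  by rewrite ?(comp_lfunNl, comp_lfunNr, comp_lfun0l, comp_lfun0r,
               comp_lfun1l, opprK, oppr0).
split=> [i|i j _|i j _ _|i j _ _].
- by rewrite cc andbb /simple_op; case: (i \in I); rewrite ?opprK ?oppr0.
- by rewrite !cc andbC.
- rewrite !cc /simple_op; case: (i \in I); case: (j \in I) => /=;
  by rewrite ?(comp_lfun0l, comp_lfun0r, comp_lfun1l).
- rewrite !cc /simple_op; case: (i \in I); case: (j \in I) => /=;
  by rewrite ?(comp_lfun0l, comp_lfun0r, comp_lfun1l).
Qed.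

Definition simple_module : hmod K n := module_of_ops simple_ops.

End SimpleModules.

(* Formal power series in x_0, x_1, x_2, ... over the integers: coefficients
   indexed by the monomials. *)
Definition power_series := {cmonom nat} -> int.
HB.instance Definition _ := GRing.Zmodule.on power_series.

Section QuasisymmetricB.
Variable n : nat.

Definition x_monomial (i : n.-tuple nat) : {cmonom nat} :=
  \big[mmul/mone]_(j < n) ucm (tnth i j).

(* For i = (i_1, ..., i_n), nth 0 (0 :: i) j is i_j, including i_0 = 0. *)
Definition admissible (I : {set 'I_n}) (i : n.-tuple nat) : Prop :=
  sorted leq (0%N :: i) /\
  forall j : 'I_n, j \in I -> (nth 0 (0 :: i) j < nth 0 (0 :: i) j.+1)%N.

(* The coefficientwise sum of the monomials of the admissible sequences; every
   monomial arises from at most one weakly increasing sequence, so the sum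
   giving its coefficient has at most one nonzero term. *)
Definition FB (I : {set 'I_n}) : power_series := fun m =>
  \sum_(i \in [set i | admissible I i]%classic) ((m == x_monomial i)%:R : int).

Definition G_domino (la : seq nat) : power_series :=
  \sum_(T : sdt n la) FB (Des T).

End QuasisymmetricB.

Definition is_partition (m : nat) (la : seq nat) : bool :=
  [&& sorted geq la, 0%N \notin la & sumn la == m].

(* Main.v *)
(** The tableaux [T] index a basis in which every generator is triangular, with
    diagonal entry [-1] or [0] according to whether [i] is a descent of [T]: a move
    [T -> s_i T] strictly increases the height, the number of vertical dominoes plus
    the sum over [k] of [k] times the top row of the domino at position [k].
    Filtering by the height gives one simple composition factor [S_(Des T)] per
    tableau.

    For [i > 0] the relations hold because, for consecutive dominoes of a standard
    tableau, sharing a row forbids the exchange and being strictly above makes it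
    possible: [pi_i] sorts positions [i] and [i + 1] for the strict partial order
    "strictly above", and such operators satisfy the braid relation for any strict
    partial order. For [i = 0], the domino with entry 1 covers
    the corner, so that [pi_1] multiplies each tableau by [-1] or [0]. *)
From HB Require Import structures.
Require Import Defs.
From mathcomp Require Import all_boot all_order all_algebra zify perm.
From mathcomp.classical Require Import boolp.
From mathcomp.reals Require Import reals.
From mathcomp.real_closed Require Import complex.

Set Implicit Arguments.
Unset Strict Implicit.
Unset Printing Implicit Defensive.

Import GRing.Theory.
Local Open Scope ring_scope.

(** * Classes in the Grothendieck group *)

Section GrothendieckClass.
Variables (K : fieldType) (n : nat).

(** An algebra element acts as a linear combination of words in the generators, and [phi] passes
    through a word letter by letter. *)
Lemma module_of_ops_equivariant (V W : vectType K) (f : 'I_n -> 'End(V))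
    (g : 'I_n -> 'End(W)) (fops : hecke_ops f) (gops : hecke_ops g)
    (phi : 'Hom(V, W)) :
  (forall i v, phi (f i v) = g i (phi v)) ->
  @hecke_equivariant K n (module_of_ops fops) (module_of_ops gops) phi.
Proof.
move=> phiE h v; rewrite /= /ops_act !eval_opsE linear_sum /=.
apply: eq_bigr => w _; rewrite linearZ /=; congr (_ *: _).
rewrite /word_op; elim: (monalg.fmonom_val w) => [|i s IH] /=; first by rewrite !id_lfunE.
by rewrite !comp_lfunE phiE IH.
Qed.

Lemma hecke_ops_restrict (V W : vectType K) (f : 'I_n -> 'End(V))
    (g : 'I_n -> 'End(W)) (phi : 'Hom(W, V)) :
  injective phi -> (forall i w, phi (g i w) = f i (phi w)) ->
  hecke_ops f -> hecke_ops g.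
Proof.
move=> inj phiE [q c b3 b4]; split=> [i|i j ij|i j i0 ij|i j i0 j1];
  apply/lfunP => w; apply: inj.
- have /lfunP/(_ (phi w)) := q i.
  by rewrite !(comp_lfunE, opp_lfunE) !linearN /= !phiE.
- have /lfunP/(_ (phi w)) := c i j ij.
  by rewrite !comp_lfunE !phiE.
- have /lfunP/(_ (phi w)) := b3 i j i0 ij.
  by rewrite !comp_lfunE !phiE.
- have /lfunP/(_ (phi w)) := b4 i j i0 j1.
  by rewrite !comp_lfunE !phiE.
Qed.

(** For a zero module [A] the sequence 0 -> A -> A -> A -> 0 is exact, hence [A] = [A] + [A]. *)
Lemma groth_class_trivial (A : hmod K n) :
  (forall v : A, v = 0) -> groth_class A = 0.
Proof.
move=> A0; have E : short_exact A A A.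
  exists \1%VF, 0; split.
  - by move=> h v; rewrite !id_lfunE.
  - by move=> h v; rewrite [LHS]A0 [RHS]A0.
  - by apply/vspaceP => v; rewrite [v]A0 !mem0v.
  - by apply/vspaceP => v; rewrite [v]A0 !mem0v.
  - by apply/vspaceP => v; rewrite [v]A0 !mem0v.
have := groth_class_exact E => /eqP.
by rewrite -[X in X == _]addr0 (inj_eq (addrI _)) => /eqP <-.
Qed.

(* The functions vanishing at a point [x0] of minimal height form a submodule
   whose quotient is the simple module of [D x0]. *)
Lemma groth_class_triangular (X : finType) (f : 'I_n -> 'End({ffun X -> K^o}))
    (fops : hecke_ops f) (D : X -> {set 'I_n}) (ht : X -> nat) :
  (forall i (v : {ffun X -> K^o}) x,
     (forall y, (ht y < ht x)%N -> v y = 0) ->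
     (f i v : {ffun X -> K^o}) x = if i \in D x then - v x else 0) ->
  groth_class (module_of_ops fops)
    = \sum_(x : X) groth_class (simple_module K (D x)).
Proof.
have [m] := ubnP #|X|; elim: m X f fops D ht => // m IH X f fops D ht leX tri.
have [/card0_eq X0|] := posnP #|X|.
  rewrite big1; last by move=> x; have := X0 x.
  apply: groth_class_trivial => v; apply/ffunP => x; by have := X0 x.
case/card_gt0P => x1 _.
pose x0 := [arg min_(x < x1) ht x].
have x0min y : (ht x0 <= ht y)%N by rewrite /x0; case: arg_minnP => // x _; apply.
pose Y := {x in predC1 x0}.
(* Extension by zero embeds the functions on [Y] as those vanishing at [x0], and evaluation at [x0]
   is the quotient map. *)
pose ext_fun (w : {ffun Y -> K^o}) : {ffun X -> K^o} :=
  [ffun x => if insub x is Some y then w y else 0].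
have ext_lin : linear ext_fun.
  move=> a u v; apply/ffunP => x; rewrite !ffunE.
  by case: insub => [y|]; rewrite ?ffunE //= scaler0 addr0.
pose ext_L := HB.pack_for {linear {ffun Y -> K^o} -> {ffun X -> K^o}} ext_fun
  (GRing.isLinear.Build _ _ _ _ ext_fun ext_lin).
pose res_fun (w : {ffun X -> K^o}) : {ffun Y -> K^o} := [ffun y => w (val y)].
have res_lin : linear res_fun by move=> a u v; apply/ffunP => x; rewrite !ffunE.
pose res_L := HB.pack_for {linear {ffun X -> K^o} -> {ffun Y -> K^o}} res_fun
  (GRing.isLinear.Build _ _ _ _ res_fun res_lin).
pose ev_fun (w : {ffun X -> K^o}) : K^o := w x0.
have ev_lin : linear ev_fun by move=> a u v; rewrite /ev_fun !ffunE.
pose ev_L := HB.pack_for {linear {ffun X -> K^o} -> K^o} ev_fun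
  (GRing.isLinear.Build _ _ _ _ ev_fun ev_lin).
pose ext := linfun ext_L; pose res := linfun res_L; pose ev := linfun ev_L.
have extE w y : (ext w : {ffun X -> K^o}) (val y) = w y.
  by rewrite lfunE /= ffunE valK.
have ext0 w : (ext w : {ffun X -> K^o}) x0 = 0.
  by rewrite lfunE /= ffunE insubF ?inE ?eqxx.
have resE w y : (res w : {ffun Y -> K^o}) y = w (val y) by rewrite lfunE /= ffunE.
have evE w : ev w = w x0 by rewrite lfunE.
have resK (w : {ffun X -> K^o}) : w x0 = 0 -> ext (res w) = w.
  move=> w0; apply/ffunP => x; have [->|nx] := eqVneq x x0; first by rewrite ext0.
  have -> : x = val (Sub x nx : Y) by rewrite SubK.
  by rewrite extE resE.
have extK w : res (ext w) = w by apply/ffunP => y; rewrite resE extE.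
pose g i : 'End({ffun Y -> K^o}) := (res \o f i \o ext)%VF.
(* By minimality of [x0] the vanishing condition in [tri] is vacuous there, so the image of [ext] is
   stable under every [f i]. *)
have fext0 i w : (f i (ext w) : {ffun X -> K^o}) x0 = 0.
  rewrite (tri i (ext w) x0) => [|y]; last by rewrite ltnNge x0min.
  by rewrite ext0 oppr0; case: ifP.
have gE i w : ext (g i w) = f i (ext w).
  by rewrite !comp_lfunE resK.
have gops : hecke_ops g.
  by apply: hecke_ops_restrict gE fops; exact: can_inj extK.
have ex : short_exact (module_of_ops gops) (module_of_ops fops)
    (simple_module K (D x0)).
  exists ext, ev; split.
  - by apply: module_of_ops_equivariant => i w; rewrite gE.
  - apply: module_of_ops_equivariant => i v.
    rewrite !evE (tri i v x0) => [|y]; last by rewrite ltnNge x0min.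
    by rewrite /simple_op; case: ifP; rewrite ?opp_lfunE ?id_lfunE ?zero_lfunE.
  - by apply/eqP/lker0P; exact: can_inj extK.
  - apply/vspaceP => v; apply/memv_imgP/idP => [[w _ ->]|].
      by rewrite memv_ker evE ext0.
    rewrite memv_ker evE => /eqP v0; exists (res v); first exact: memvf.
    by rewrite resK.
  - apply/vspaceP => a; rewrite memvf; apply/memv_imgP.
    exists [ffun=> a]; first exact: memvf.
    by rewrite evE ffunE.
rewrite (groth_class_exact ex) (bigD1 x0) //= addrC; congr (_ + _).
rewrite (IH Y g gops (fun y => D (val y)) (fun y => ht (val y))).
- by rewrite (big_sub (predC1 x0)).
- rewrite card_sub -ltnS; apply: leq_trans leX; rewrite !ltnS.
  by rewrite (eq_card (_ : _ =i predC1 x0)) // cardC1 prednK // (cardD1 x0).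
- move=> i v y vy; rewrite -extE gE tri ?extE // => z lz.
  have [->|nz] := eqVneq z x0; first by rewrite ext0.
  have -> : z = val (Sub z nz : Y) by rewrite SubK.
  by rewrite extE; apply: vy; rewrite SubK.
Qed.
End GrothendieckClass.

(** * Standard domino tableaux *)

Lemma ord_predE n (i : 'I_n) : (0 < i)%N -> ord_pred i = i.-1 :> nat.
Proof.
by case: i => [[|k] lt_kn] //= _; rewrite modnDr modn_small // ltnW.
Qed.

Lemma tperm_predE n (i k : 'I_n) : (0 < i)%N ->
  tperm (ord_pred i) i k =
    (if k == i :> nat then i.-1 else if k == i.-1 :> nat then i else k) :> nat.
Proof.
move=> i0; have pi := ord_predE i0.
have kE (l : 'I_n) : (k == l :> nat) = (k == l) by [].
case: tpermP => [->|->|/eqP nk /eqP nk']; rewrite ?eqxx ?pi //.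
  by rewrite (_ : (i.-1 == i :> nat) = false) ?eqxx; last by lia.
by rewrite kE (negPf nk') -pi kE (negPf nk).
Qed.

Section Tableaux.
Variables (n : nat) (la : seq nat).
Implicit Types (d : domino n) (f : {ffun 'I_n -> domino n}) (i j : 'I_n).

(** The left side is the bottom row of [d1]: a vertical domino reaches one row further down. *)
Definition above d1 d2 : bool := (d1.1.1 + d1.2 < d2.1.1)%N.

Lemma cell_mem d x : x \in cells d ->
  [/\ (d.1.1 <= x.1 <= d.1.1 + d.2)%N & (d.1.2 <= x.2 <= d.1.2 + ~~ d.2)%N].
Proof.
case: d => [[r c] [|]]; rewrite !inE => /orP[] /eqP -> /=; split; lia.
Qed.

Lemma above_cells d1 d2 :
  all (fun x => all (fun y => x.1 < y.1)%N (cells d2)) (cells d1) = above d1 d2.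
Proof.
rewrite /above.
by case: d1 d2 => [[r c] [|]] [[r' c'] [|]] /=; rewrite ?andbT; lia.
Qed.

Lemma above_trans d1 d2 d3 : above d1 d2 -> above d2 d3 -> above d1 d3.
Proof. by rewrite /above; lia. Qed.

Lemma above_irr d : above d d = false.
Proof. by rewrite /above; lia. Qed.

Lemma above_mem d1 d2 x y : above d1 d2 -> x \in cells d1 -> y \in cells d2 ->
  (x.1 < y.1)%N.
Proof. by rewrite /above => ab /cell_mem[? _] /cell_mem[? _]; lia. Qed.

(** The rows met by a domino form an interval. Two intervals neither of which precedes the other
    both contain the larger of their first elements. *)
Lemma not_above_row d1 d2 : ~~ above d1 d2 -> ~~ above d2 d1 ->
  exists x y, [/\ x \in cells d1, y \in cells d2 & x.1 = y.1].
Proof.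
rewrite /above; case: d1 d2 => [[r c] v] [[r' c'] v'] /= n1 n2.
have H d x1 : (d.1.1 <= x1 <= d.1.1 + d.2)%N ->
    exists2 x, x \in cells d & x.1 = x1.
  case: d => [[s e] [|]] /= h; last first.
    by exists (s : nat, e : nat); rewrite ?mem_head //=; lia.
  have [->|ne] := eqVneq x1 s; first by exists (s : nat, e : nat); rewrite ?mem_head.
  by exists (s.+1, e : nat); rewrite ?inE ?eqxx ?orbT //=; lia.
have [|x xd xm] := H (r, c, v) (maxn r r') => /=; first by lia.
have [|y yd ym] := H (r', c', v') (maxn r r') => /=; first by lia.
by exists x, y; split=> //; rewrite xm ym.
Qed.

Definition swap_entries i f : {ffun 'I_n -> domino n} :=
  [ffun k => f (tperm (ord_pred i) i k)].

(** Exchanging consecutive entries changes the relative order of that pair only, and a violation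
    there would need a cell of the lower domino weakly above one of the upper domino. *)
Lemma swap_entries_sdt i f : (0 < i)%N -> is_sdt la f ->
  above (f i) (f (ord_pred i)) -> is_sdt la (swap_entries i f).
Proof.
move=> i0 [f1 f2 f3] ab; have pi := ord_predE i0.
set t := tperm (ord_pred i) i; split.
- by move=> k x; rewrite ffunE; exact: f1.
- move=> x /f2[k [kx ku]]; exists (t k); split; first by rewrite ffunE tpermK.
  by move=> k'; rewrite ffunE => /ku ->; rewrite tpermK.
- move=> k l x y; rewrite !ffunE => xk yl le.
  have := f3 _ _ _ _ xk yl le; rewrite leqNgt; apply: contraNT; rewrite -ltnNge.
  move=> lk; rewrite ltnNge; apply/negP => tkl; move: xk yl.
  have [ek el] : k = i /\ l = ord_pred i.
    by split; apply: ord_inj; move: tkl; rewrite /t !tperm_predE // ?pi;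
      do 4?case: eqP => ?; lia.
  rewrite ek el tpermL tpermR => xk yl.
  by have := above_mem ab yl xk; case: le; lia.
Qed.

(** The two dominoes share a row, which forces the order of their entries. *)
Lemma swap_entries_not_sdt i f : (0 < i)%N -> is_sdt la f ->
  ~~ above (f (ord_pred i)) (f i) -> ~~ above (f i) (f (ord_pred i)) ->
  ~ is_sdt la (swap_entries i f).
Proof.
move=> i0 [_ _ f3] n1 n2 [_ _ g3]; have pi := ord_predE i0.
have [x [y [xf yf xy]]] := not_above_row n1 n2.
have [le|/ltnW le] := leqP x.2 y.2.
  have := g3 i (ord_pred i) x y; rewrite !ffunE tpermL tpermR pi => /(_ xf yf).
  by move/(_ (or_introl (conj xy le))); lia.
have := f3 _ _ _ _ yf xf (or_introl (conj (esym xy) le)); rewrite pi; lia.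
Qed.

Lemma swap_entriesL i f : swap_entries i f (ord_pred i) = f i.
Proof. by rewrite ffunE tpermL. Qed.

Lemma swap_entriesR i f : swap_entries i f i = f (ord_pred i).
Proof. by rewrite ffunE tpermR. Qed.

Lemma swap_entriesD i f k : ord_pred i != k -> i != k -> swap_entries i f k = f k.
Proof. by move=> *; rewrite ffunE tpermD. Qed.

(** When [f i] is the horizontal domino in the corner, this says that the next domino lies right
    below it, completing the 2 x 2 square. *)
Definition stacked i f : bool :=
  [&& (f (ordS i)).1.1 == 1%N :> nat, (f (ordS i)).1.2 == 0%N :> nat
    & ~~ (f (ordS i)).2].

Lemma mem_corner d : (d.1.1 : nat, d.1.2 : nat) \in cells d.
Proof. by case: d => [[r c] v]; rewrite mem_head. Qed.

Lemma in_diagram_down m r c r' c' : is_partition m la ->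
  in_diagram la (r, c) -> (r' <= r)%N -> (c' <= c)%N -> in_diagram la (r', c').
Proof.
case/and3P=> la_sorted _ _; rewrite /in_diagram /= => lt_c le_r le_c.
have lt_r : (r < size la)%N by rewrite ltnNge; apply/negP => /(nth_default 0%N); lia.
have := sorted_leq_nth (rev_trans leq_trans) leqnn 0%N la_sorted r' r.
by rewrite !inE => /(_ (leq_ltn_trans le_r lt_r) lt_r le_r); lia.
Qed.

(** From a cell of the first domino, go up to row 0 and then left to the corner: entries weakly
    decrease along the way, so the corner belongs to the first domino. *)
Lemma is_sdt_corner m i f : is_partition m la -> is_sdt la f -> i = 0%N :> nat ->
  (f i).1.1 = 0%N :> nat /\ (f i).1.2 = 0%N :> nat.
Proof.
move=> la_part [f1 f2 f3] i0; have down := in_diagram_down la_part.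
have xi := mem_corner (f i).
have xd := f1 _ _ xi.
have /f2[k [k00 _]] := down _ _ _ _ xd (leq0n _) (leq0n _).
have /f2[l [l0c _]] := down _ _ _ _ xd (leq0n _) (leqnn _).
have kl := f3 _ _ _ _ k00 l0c (or_introl (conj erefl (leq0n _))).
have li := f3 _ _ _ _ l0c xi (or_intror (conj erefl (leq0n _))).
have ki : k = i by apply: ord_inj; lia.
by move: k00; rewrite ki => /cell_mem[] /=; lia.
Qed.

Lemma tile_northwest_horizontal i f :
  (f i).1.1 = 0%N :> nat -> (f i).1.2 = 0%N :> nat -> ~~ (f i).2 ->
  tile_northwest f i = stacked i f.
Proof.
rewrite /tile_northwest /stacked.
case: (f i) (f (ordS i)) => [[r0 c0] v0] [[r c] v] /= -> -> /negPf -> /=.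
rewrite !perm_cons; apply/idP/idP => [|/and3P[/eqP -> /eqP -> /negPf -> //]].
move/perm_mem => E.
have := E (r : nat, c : nat); have := E (if v then (r.+1, c : nat) else (r : nat, c.+1)).
by rewrite !inE !eqxx ?orbT /=; case: v {E}; rewrite !xpair_eqE; lia.
Qed.

(** A positive index [j] forces [n > 1], so the cyclic successor of 0 does not wrap around. *)
Lemma ordS0E i j : i = 0%N :> nat -> (0 < j)%N -> ordS i = 1%N :> nat.
Proof. by move=> /= -> j0; rewrite modn_small // (leq_ltn_trans j0). Qed.

Lemma stacked_ordS i f : i = 0%N :> nat -> (f i).1.1 = 0%N :> nat ->
  stacked i f -> ordS i = 1%N :> nat.
Proof.
move=> i0 fi /and3P[/eqP fS _ _]; apply: (@ordS0E i (ordS i)) => //.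
rewrite lt0n; apply/eqP => S0; move: fS; rewrite (_ : ordS i = i) ?fi //.
by apply: ord_inj; rewrite S0 i0.
Qed.

(** * Switching the two dominoes of the corner square *)

Section SwitchFirst.
Variables (i : 'I_n) (f : {ffun 'I_n -> domino n}).
Hypotheses (i0 : i = 0%N :> nat) (fr : (f i).1.1 = 0%N :> nat)
  (fc : (f i).1.2 = 0%N :> nat) (fh : ~~ (f i).2) (st : stacked i f).

(** The diagonal cells of the square keep their entries and the other two cells exchange theirs. As
    a permutation of entries depending on the cell, the switch visibly keeps each cell covered
    exactly once. *)
Lemma switch_first_cells k x : x \in cells (switch_first f k) =
  (x \in cells (f ((if x \in [:: (0, 1); (1, 0)]%N then tperm i (ordS i) else 1%g) k))).
Proof.
have S1 := stacked_ordS i0 fr st; have /and3P[/eqP Sr /eqP Sc Sh] := st.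
have ci : cells (f i) = [:: (0, 0); (0, 1)]%N.
  by move: fr fc fh; case: (f i) => [[r c] v] /= -> -> /negPf ->.
have cS : cells (f (ordS i)) = [:: (1, 0); (1, 1)]%N.
  by move: Sr Sc Sh; case: (f _) => [[r c] v] /= -> -> /negPf ->.
have [->|ki] := eqVneq k i.
  have -> : cells (switch_first f i) = [:: (0, 0); (1, 0)]%N.
    rewrite ffunE i0 /=.
    by move: fr fc fh; case: (f i) => [[r c] v] /= -> -> /negPf ->.
  case: ifP; rewrite ?tpermL ?perm1 ?ci ?cS; rewrite !inE;
    case: x => a b; rewrite !xpair_eqE; lia.
have [->|kS] := eqVneq k (ordS i).
  have -> : cells (switch_first f (ordS i)) = [:: (0, 1); (1, 1)]%N.
    rewrite ffunE S1 /=.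
    by move: Sr Sc Sh; case: (f _) => [[r c] v] /= -> -> /negPf ->.
  case: ifP; rewrite ?tpermR ?perm1 ?ci ?cS; rewrite !inE;
    case: x => a b; rewrite !xpair_eqE; lia.
have k2 : (k < 2)%N = false.
  apply/negP => k2; move/eqP: ki => ki; move/eqP: kS => kS.
  have [k0|k1] : (k = 0 :> nat \/ k = 1 :> nat)%N by lia.
    by apply: ki; apply: ord_inj; rewrite k0 i0.
  by apply: kS; apply: ord_inj; rewrite k1 S1.
by rewrite ffunE k2; case: ifP; rewrite ?perm1 // tpermD // eq_sym.
Qed.

Lemma switch_first_sdt : is_sdt la f -> is_sdt la (switch_first f).
Proof.
case=> f1 f2 f3; have S1 := stacked_ordS i0 fr st.
set s := fun x : nat * nat =>
  (if x \in [:: (0, 1); (1, 0)]%N then tperm i (ordS i) else 1%g).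
have sE k x : x \in cells (switch_first f k) = (x \in cells (f (s x k))).
  exact: switch_first_cells.
split.
- by move=> k x; rewrite sE; exact: f1.
- move=> x /f2[k [kx ku]]; exists ((s x)^-1%g k); split; first by rewrite sE permKV.
  by move=> k'; rewrite sE => /ku ->; rewrite permK.
- move=> k l x y xk yl le.
  (* The first two entries are permuted among themselves, so comparisons with later entries survive.
     Only the pair formed by the second and the first domino has to be checked on cells. *)
  have s2 z (m : 'I_n) : (s z m < 2)%N = (m < 2)%N /\ ((2 <= m)%N -> s z m = m).
    rewrite /s; case: ifP => _; last by rewrite perm1.
    by case: tpermP => [->|->|]; rewrite ?i0 ?S1.
  have [k2|k2] := ltnP k 2; last first.
    rewrite sE in xk; rewrite sE in yl; have := f3 _ _ _ _ xk yl le.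
    have [_ /(_ k2) ->] := s2 x k; have [e el] := s2 y l.
    by have [l2|/el ->] := ltnP l 2; first lia.
  have [l2|l2] := ltnP l 2; last by lia.
  rewrite leqNgt; apply/negP => lk.
  have ek : k = ordS i by apply: ord_inj; lia.
  have el : l = i by apply: ord_inj; lia.
  move: xk yl le; rewrite ek el !ffunE i0 S1 /=; move: fr fc fh st.
  rewrite /stacked; case: (f i) (f (ordS i)) => [[r c] v] [[r' c'] v'] /= -> -> /negPf ->.
  case/and3P=> /eqP -> /eqP -> /negPf -> /=.
  by rewrite !inE => /orP[] /eqP -> /orP[] /eqP -> /=; lia.
Qed.

End SwitchFirst.

End Tableaux.

(** * The action of the generators on tableaux *)

Section Operators.
Variables (K : fieldType) (n : nat) (la : seq nat).
Implicit Types (f : {ffun 'I_n -> domino n}) (i j : 'I_n).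

(* The zero vector unless [f] is a standard domino tableau. *)
Definition tab f : sdt_space K n la := [ffun U => (sdt_val U == f)%:R].

Lemma sdt_basisE (T : sdt n la) : sdt_basis K T = tab T.
Proof. by apply/ffunP => U; rewrite !ffunE. Qed.

Lemma tab_insub f :
  (if insub f is Some U then sdt_basis K U else 0 : sdt_space K n la) = tab f.
Proof.
case: insubP => [U _ <-|nf]; first exact: sdt_basisE.
apply/ffunP => U; rewrite !ffunE; case: eqP => // e.
by move: nf; rewrite -e (valP U).
Qed.

Lemma tab_not_sdt f : ~ is_sdt la f -> tab f = 0.
Proof.
move=> nf; apply/ffunP => U; rewrite !ffunE; case: eqP => // e.
by case: nf; rewrite -e; apply/asboolP/(valP U).
Qed.

Lemma lfun_tab_eq (A B : 'End(sdt_space K n la)) :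
  (forall f, is_sdt la f -> A (tab f) = B (tab f)) -> A = B.
Proof.
move=> AB; apply/lfunP => v.
have -> : v = \sum_(T : sdt n la) (v : {ffun sdt n la -> K^o}) T *: tab T.
  apply/ffunP => U; rewrite sum_ffunE (bigD1 U) //= big1 => [|T TU].
    by rewrite !ffunE eqxx addr0 [_ *: _]mulr1.
  by rewrite !ffunE val_eqE eq_sym (negPf TU) scaler0.
rewrite !linear_sum; apply: eq_bigr => T _; rewrite !linearZ /=.
by rewrite AB //; apply/asboolP/(valP T).
Qed.

(** Standardness of the exchange turns into a comparison of two dominoes: if neither is above the
    other, the exchanged filling is not standard and its [tab] is zero. *)
Lemma sdt_op_pos i f : (0 < i)%N -> is_sdt la f ->
  sdt_op K la i (tab f) =
    if above (f (ord_pred i)) (f i) then - tab f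
    else if above (f i) (f (ord_pred i)) then tab (swap_entries i f) else 0.
Proof.
move=> i0 fP; have [T eT] : exists T : sdt n la, sdt_val T = f.
  by exists (Sdt (asboolT fP)).
have in0 : (i == 0%N :> nat) = false by lia.
rewrite -eT -sdt_basisE sdt_op_basis /sdt_pi inE /is_descent in0 above_cells.
case: ifPn => // n1; rewrite /sdt_s in0 tab_insub.
case: ifPn => // n2; apply: tab_not_sdt; apply: swap_entries_not_sdt => //.
by rewrite eT.
Qed.

Variables (m : nat) (la_part : is_partition m la).

Lemma sdt_op_zero i f : i = 0%N :> nat -> is_sdt la f ->
  sdt_op K la i (tab f) =
    if (f i).2 then - tab f
    else if stacked i f then tab (switch_first f) else 0.
Proof.
move=> i0 fP; have [T eT] : exists T : sdt n la, sdt_val T = f.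
  by exists (Sdt (asboolT fP)).
have [fr fc] := is_sdt_corner la_part fP i0.
rewrite -eT in fr fc *.
rewrite -sdt_basisE sdt_op_basis /sdt_pi inE /is_descent i0 eqxx /vertical.
case: ifPn => // fh; rewrite /sdt_s i0 eqxx tile_northwest_horizontal //.
by case: ifP => // _; rewrite tab_insub.
Qed.

Lemma switch_first_valid i f : i = 0%N :> nat -> is_sdt la f -> ~~ (f i).2 ->
  stacked i f -> is_sdt la (switch_first f).
Proof.
move=> i0 fP fh st; have [fr fc] := is_sdt_corner la_part fP i0.
exact: (switch_first_sdt i0 fr fc fh st fP).
Qed.

End Operators.

(** * The Hecke relations *)

(** The states carry labels [x], [y], [z] at three positions; [A] sorts the first two and [B] the
    last two. For each possible order on the labels, both sides evaluate to the same signed state or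
    to 0; [braid] identifies the states reached from a fully reversed triple. *)
Lemma sorting_operators_braid (D S : Type) (V : zmodType) (lt : rel D)
    (e : S -> V) (valid : S -> Prop) (x y z : S -> D) (s t : S -> S) (A B : V -> V) :
  transitive lt -> irreflexive lt ->
  A 0 = 0 -> B 0 = 0 -> {morph A : u / - u} -> {morph B : u / - u} ->
  (forall f, valid f -> A (e f) =
     if lt (x f) (y f) then - e f else if lt (y f) (x f) then e (s f) else 0) ->
  (forall f, valid f -> B (e f) =
     if lt (y f) (z f) then - e f else if lt (z f) (y f) then e (t f) else 0) ->
  (forall f, valid f -> lt (y f) (x f) -> valid (s f)) ->
  (forall f, valid f -> lt (z f) (y f) -> valid (t f)) ->
  (forall f, [/\ x (s f) = y f, y (s f) = x f & z (s f) = z f]) ->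
  (forall f, [/\ x (t f) = x f, y (t f) = z f & z (t f) = y f]) ->
  (forall f, s (t (s f)) = t (s (t f))) ->
  forall f, valid f -> A (B (A (e f))) = B (A (B (e f))).
Proof.
move=> lt_trans lt_irr A0 B0 AN BN AE BE sP tP sE tE braid f fP.
have lt_asym a b : lt a b -> lt b a = false.
  by move=> ab; apply/negP => /(lt_trans _ _ _ ab); rewrite lt_irr.
have xs g : x (s g) = y g by case: (sE g).
have ys g : y (s g) = x g by case: (sE g).
have zs g : z (s g) = z g by case: (sE g).
have xt g : x (t g) = x g by case: (tE g).
have yt g : y (t g) = z g by case: (tE g).
have zt g : z (t g) = y g by case: (tE g).
have E := (xs, ys, zs, xt, yt, zt).
have cmp a b : [\/ lt a b /\ lt b a = false, lt a b = false /\ lt b a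
    | lt a b = false /\ lt b a = false].
  case ab: (lt a b); first by rewrite (lt_asym _ _ ab); constructor 1.
  by case: (lt b a); [constructor 2 | constructor 3].
have [] := cmp (x f) (y f) => -[E1 E2]; have [] := cmp (y f) (z f) => -[E3 E4];
  have [] := cmp (x f) (z f) => -[E5 E6];
  (* Combinations of the three comparisons that contradict transitivity are discarded. *)
  try (by move: (lt_trans _ _ _ E1 E3); rewrite E5);
  try (by move: (lt_trans _ _ _ E4 E2); rewrite E6);
  try (by move: (lt_trans _ _ _ E5 E4); rewrite E1);
  try (by move: (lt_trans _ _ _ E2 E5); rewrite E3);
  try (by move: (lt_trans _ _ _ E6 E1); rewrite E4);
  try (by move: (lt_trans _ _ _ E3 E6); rewrite E2);
  have F := (E1, E2, E3, E4, E5, E6);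
  repeat first
    [ progress rewrite ?A0 ?B0 ?AN ?BN ?opprK ?oppr0
    | rewrite AE; [rewrite ?E ?F
        | by repeat first [assumption | apply: sP | apply: tP | rewrite ?E ?F]]
    | rewrite BE; [rewrite ?E ?F
        | by repeat first [assumption | apply: sP | apply: tP | rewrite ?E ?F]] ];
  by rewrite ?braid.
Qed.

Section Relations.
Variables (K : fieldType) (n m : nat) (la : seq nat).
Hypothesis la_part : is_partition m la.
Implicit Types (f : {ffun 'I_n -> domino n}) (i j k : 'I_n).

Local Notation op := (@sdt_op K n la).
Local Notation tab := (@tab K n la).

(** A move made by [op i] creates a descent at [i], on which [op i] acts as -1. *)
Lemma sdt_op_quadratic i : (op i \o op i)%VF = - op i.
Proof.
apply: lfun_tab_eq => f fP; rewrite comp_lfunE opp_lfunE.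
have [i0|i0] := posnP i.
  rewrite (sdt_op_zero K la_part i0 fP).
  case: ifPn => fh; first by rewrite linearN /= (sdt_op_zero K la_part i0 fP) fh.
  case: ifPn => st; last by rewrite !linear0.
  rewrite (sdt_op_zero K la_part i0 (switch_first_valid la_part i0 fP fh st)).
  by rewrite ffunE i0 /=; case: (f i) fh => [[r c] v] /= ->.
rewrite (sdt_op_pos K i0 fP).
case: ifPn => ab; first by rewrite linearN /= (sdt_op_pos K i0 fP) ab.
case: ifPn => ba; last by rewrite !linear0.
rewrite (sdt_op_pos K i0 (swap_entries_sdt i0 fP ba)).
by rewrite swap_entriesL swap_entriesR ba.
Qed.

Lemma ord_neq i j : (i : nat) <> j -> i != j.
Proof. by move=> ij; apply/eqP => e; case: ij; rewrite e. Qed.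

(** Neither move affects the tests that govern the other operator, so the two case distinctions are
    independent and the moves [s] and [t] can be made in either order. *)
Lemma local_operators_commute (A B : 'End(sdt_space K n la))
    (a1 a2 b1 b2 : {ffun 'I_n -> domino n} -> bool)
    (s t : {ffun 'I_n -> domino n} -> {ffun 'I_n -> domino n}) :
  (forall f, is_sdt la f ->
     A (tab f) = if a1 f then - tab f else if a2 f then tab (s f) else 0) ->
  (forall f, is_sdt la f ->
     B (tab f) = if b1 f then - tab f else if b2 f then tab (t f) else 0) ->
  (forall f, is_sdt la f -> ~~ a1 f -> a2 f -> is_sdt la (s f)) ->
  (forall f, is_sdt la f -> ~~ b1 f -> b2 f -> is_sdt la (t f)) ->
  (forall f, a1 (t f) = a1 f /\ a2 (t f) = a2 f) ->
  (forall f, b1 (s f) = b1 f /\ b2 (s f) = b2 f) ->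
  (forall f, s (t f) = t (s f)) ->
  (A \o B = B \o A)%VF.
Proof.
move=> AE BE sP tP at_ bs st; apply: lfun_tab_eq => f fP; rewrite !comp_lfunE.
have [a1t a2t] := at_ f; have [b1s b2s] := bs f; rewrite (AE f fP) (BE f fP).
have [a1f|a1f] := boolP (a1 f); have [b1f|b1f] := boolP (b1 f).
- by rewrite !linearN /= (AE f fP) (BE f fP) a1f b1f.
- rewrite linearN /= (BE f fP) (negPf b1f).
  case: ifP => b2f; last by rewrite !linear0.
  by rewrite (AE _ (tP f fP b1f b2f)) a1t a1f.
- rewrite linearN /= (AE f fP) (negPf a1f).
  case: ifP => a2f; last by rewrite !linear0.
  by rewrite (BE _ (sP f fP a1f a2f)) b1s b1f.
- have [a2f|a2f] := boolP (a2 f); have [b2f|b2f] := boolP (b2 f).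
  + rewrite (BE _ (sP f fP a1f a2f)) (AE _ (tP f fP b1f b2f)).
    by rewrite b1s b2s a1t a2t (negPf a1f) (negPf b1f) a2f b2f st.
  + by rewrite linear0 (BE _ (sP f fP a1f a2f)) b1s b2s (negPf b1f) (negPf b2f).
  + by rewrite linear0 (AE _ (tP f fP b1f b2f)) a1t a2t (negPf a1f) (negPf a2f).
  + by rewrite !linear0.
Qed.

Lemma sdt_op_commute_pos i j : (0 < i)%N -> (i.+1 < j)%N ->
  (op i \o op j)%VF = (op j \o op i)%VF.
Proof.
move=> i0 ij; have j0 : (0 < j)%N by lia.
have pi := ord_predE i0; have pj := ord_predE j0.
have d1 : ord_pred i != ord_pred j by apply: ord_neq; rewrite pi pj; lia.
have d2 : ord_pred i != j by apply: ord_neq; rewrite pi; lia.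
have d3 : i != ord_pred j by apply: ord_neq; rewrite pj; lia.
have d4 : i != j by apply: ord_neq; lia.
apply: (local_operators_commute (fun f => sdt_op_pos K i0 (f := f))
  (fun f => sdt_op_pos K j0 (f := f))) => f.
- by move=> fP _; exact: swap_entries_sdt.
- by move=> fP _; exact: swap_entries_sdt.
- by rewrite !swap_entriesD // eq_sym.
- by rewrite !swap_entriesD.
- apply/ffunP => k; rewrite !ffunE; congr (f _).
  case: (tpermP (ord_pred i) i k) => [->|->|/eqP k1 /eqP k2].
  + by rewrite (tpermD (z := ord_pred i)) 1?eq_sym // tpermL tpermD // eq_sym.
  + by rewrite (tpermD (z := i)) 1?eq_sym // tpermR tpermD // eq_sym.
  + by case: (tpermP (ord_pred j) j k) => [_|_|/eqP k3 /eqP k4];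
      rewrite tpermD // eq_sym.
Qed.

Lemma sdt_op_commute_zero_far i j : i = 0%N :> nat -> (2 < j)%N ->
  (op i \o op j)%VF = (op j \o op i)%VF.
Proof.
move=> i0 j2; have j0 : (0 < j)%N by lia.
have S1 := ordS0E i0 j0; have pj := ord_predE j0.
have sw f k : (k < 2)%N -> swap_entries j f k = f k.
  by move=> k2; rewrite swap_entriesD //; apply: ord_neq; rewrite ?pj; lia.
apply: (local_operators_commute (fun f => sdt_op_zero K la_part i0 (f := f))
  (fun f => sdt_op_pos K j0 (f := f))) => f.
- by move=> fP fh st; exact: (switch_first_valid la_part i0 fP fh st).
- by move=> fP _; exact: swap_entries_sdt.
- by rewrite /stacked !sw ?i0 ?S1.
- rewrite ![switch_first _ _]ffunE pj.
  by rewrite (_ : (j < 2)%N = false) 1?(_ : (j.-1 < 2)%N = false) //; lia.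
- apply/ffunP => k; rewrite !ffunE.
  have -> : (tperm (ord_pred j) j k < 2)%N = (k < 2)%N.
    by rewrite tperm_predE //; do 2?case: eqP => ?; lia.
  by case: ifP.
Qed.

(** Both operators involve the second domino, so locality fails and the geometry near the corner
    decides. *)
Lemma sdt_op_commute_zero_two i j : i = 0%N :> nat -> j = 2%N :> nat ->
  (op i \o op j)%VF = (op j \o op i)%VF.
Proof.
move=> i0 j2; have j0 : (0 < j)%N by lia.
have S1 := ordS0E i0 j0; have pj : ord_pred j = ordS i.
  by apply: ord_inj; rewrite ord_predE // S1 j2.
have swi f : swap_entries j f i = f i.
  by rewrite swap_entriesD ?pj //; apply: ord_neq; rewrite ?S1 ?i0 ?j2.
have swj f : swap_entries j f j = f (ordS i) by rewrite swap_entriesR pj.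
have swS f : swap_entries j f (ordS i) = f j by rewrite -pj swap_entriesL.
apply: lfun_tab_eq => f fP; rewrite !comp_lfunE.
have [fr fc] := is_sdt_corner la_part fP i0.
have Oi := sdt_op_zero K la_part i0 fP; have Oj := sdt_op_pos K j0 fP.
rewrite pj in Oj.
have swP := @swap_entries_sdt _ la j f j0 fP; rewrite pj in swP.
have [fv|fh] := boolP (f i).2.
  rewrite fv in Oi; rewrite Oi linearN /= Oj.
  case: ifP => _; first by rewrite linearN /= Oi.
  case: ifP => ba; last by rewrite !linear0.
  by rewrite (sdt_op_zero K la_part i0 (swP ba)) swi fv.
rewrite (negPf fh) in Oi.
have [st|nst] := boolP (stacked i f).
  rewrite st in Oi.
  have gP := switch_first_valid la_part i0 fP fh st.
  have /and3P[/eqP Sr /eqP Sc /negPf Sh] := st.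
  have gj : switch_first f j = f j by rewrite ffunE j2.
  have gS : switch_first f (ordS i) = reflect_domino (f (ordS i)) by rewrite ffunE S1.
  rewrite Oi Oj (sdt_op_pos K j0 gP) pj gj gS.
  (* The switch keeps the bottom row of the second domino, which is row 1. *)
  have -> : above (reflect_domino (f (ordS i))) (f j) = above (f (ordS i)) (f j).
    move: Sr Sc Sh; rewrite /above.
    by case: (f (ordS i)) => [[r c] v] /= -> -> ->.
  (* The reflected second domino starts in row 0, and nothing lies above it. *)
  have -> : above (f j) (reflect_domino (f (ordS i))) = false.
    by move: Sc; rewrite /above; case: (f (ordS i)) => [[r c] v] /= ->.
  case: ifP => _; first by rewrite linearN /= Oi.
  case: ifP => ba; last by rewrite linear0.
  rewrite (sdt_op_zero K la_part i0 (swP ba)) swi (negPf fh).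
  (* To be stacked after the exchange, the third domino would have to start in row 1, yet it lies
     above the second one, which starts in row 1 too. *)
  case: ifP => // /and3P[/eqP + _ _]; rewrite swS => r1.
  by move: ba; rewrite /above Sr r1; lia.
rewrite (negPf nst) in Oi; rewrite Oi linear0 Oj.
case: ifP => _; first by rewrite linearN /= Oi oppr0.
case: ifP => ba; last by rewrite linear0.
rewrite (sdt_op_zero K la_part i0 (swP ba)) swi (negPf fh).
case: ifP => // /and3P[/eqP + /eqP +]; rewrite swS => r1 c0 h.
(* The second domino lies strictly below the third, which fills the lower half of
   the corner square. The top cell of the column of the second domino has a smaller
   entry, hence is in the first one; so the third domino meets that column too, above
   the second. *)
have [f1 f2 f3] := fP.
have xS := mem_corner (f (ordS i)).
have above_S : (1 < (f (ordS i)).1.1)%N by move: ba; rewrite /above r1; lia.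
have /f2[k [kx _]] := in_diagram_down la_part (f1 _ _ xS) (leq0n _) (leqnn _).
have kS := f3 _ _ _ _ kx xS (or_intror (conj erefl (leq0n _))).
have ki : k = i.
  apply: ord_inj; have [k1|] := eqVneq (k : nat) 1%N; last by lia.
  have kE : k = ordS i by apply: ord_inj; rewrite k1.
  by move: kx; rewrite kE => /cell_mem[] /=; lia.
have y2 : (1, (f (ordS i)).1.2 : nat)%N \in cells (f j).
  move: kx; rewrite ki => /cell_mem[_] /=; rewrite fc.
  move: r1 c0 h; case: (f j) => [[r c] v] /= -> -> /negPf ->.
  by rewrite !inE !xpair_eqE; case: (f i).2; lia.
by have := f3 _ _ _ _ y2 xS (or_intror (conj erefl (ltnW above_S))); lia.
Qed.

(** No domino is above the first one, so [op j] scales every tableau. If [op i] scales [f] too, both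
    sides agree by commutativity of scalars; otherwise [op i] switches the corner square and both
    sides vanish. *)
Lemma sdt_op_braid4 i j : i = 0%N :> nat -> j = 1%N :> nat ->
  (op i \o op j \o op i \o op j = op j \o op i \o op j \o op i)%VF.
Proof.
move=> i0 j1; have j0 : (0 < j)%N by lia.
have pj : ord_pred j = i by apply: ord_inj; rewrite ord_predE // j1 i0.
have jS : ordS i = j by apply: ord_inj; rewrite (ordS0E i0 j0) j1.
have Oj f : is_sdt la f -> op j (tab f) = if above (f i) (f j) then - tab f else 0.
  move=> fP; rewrite (sdt_op_pos K j0 fP) pj.
  case: ifP => // _; case: ifP => //.
  by have [fr _] := is_sdt_corner la_part fP i0; rewrite /above fr.
apply: lfun_tab_eq => f fP; rewrite !comp_lfunE.
have Oi := sdt_op_zero K la_part i0 fP.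
have [y Ojy] : exists y, op j (tab f) = y *: tab f.
  rewrite (Oj _ fP); case: ifP => _; first by exists (-1); rewrite scaleN1r.
  by exists 0; rewrite scale0r.
have scalar x : op i (tab f) = x *: tab f ->
    op i (op j (op i (op j (tab f)))) = op j (op i (op j (op i (tab f)))).
  move=> Oix.
  have OiZ z : op i (z *: tab f) = (z * x) *: tab f by rewrite linearZ /= Oix scalerA.
  have OjZ z : op j (z *: tab f) = (z * y) *: tab f by rewrite linearZ /= Ojy scalerA.
  rewrite Oix Ojy !(OiZ, OjZ); congr (_ *: _).
  by rewrite -!mulrA [RHS]mulrC -!mulrA.
have [fv|fh] := boolP (f i).2.
  by apply: (scalar (-1)); rewrite Oi fv scaleN1r.
rewrite (negPf fh) in Oi.
have [st|nst] := boolP (stacked i f); last first.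
  by apply: (scalar 0); rewrite Oi (negPf nst) scale0r.
rewrite st in Oi.
have gP := switch_first_valid la_part i0 fP fh st.
(* After the switch the second domino starts in row 0, so the first one is not above it. *)
have Og : op j (tab (switch_first f)) = 0.
  rewrite (Oj _ gP) !ffunE i0 j1 /=; case: ifP => //.
  have /and3P[_ /eqP + _] := st; rewrite jS /above.
  by case: (f j) (f i) => [[r c] v] [[r' c'] v'] /= ->.
by rewrite Oi Og linear0 Ojy !linearZ /= Oi Og !(linear0, scaler0).
Qed.

Lemma sdt_op_braid3 i j : (0 < i)%N -> j = i.+1 :> nat ->
  (op i \o op j \o op i = op j \o op i \o op j)%VF.
Proof.
move=> i0 ij; have j0 : (0 < j)%N by lia.
have pj : ord_pred j = i by apply: ord_inj; rewrite ord_predE // ij.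
set p := ord_pred i; have pi : p = i.-1 :> nat := ord_predE i0.
have pNi : p != i by apply: ord_neq; lia.
have pNj : p != j by apply: ord_neq; lia.
have iNj : i != j by apply: ord_neq; lia.
have sE f : [/\ swap_entries i f p = f i, swap_entries i f i = f p
    & swap_entries i f j = f j].
  by split; [exact: swap_entriesL | exact: swap_entriesR | rewrite swap_entriesD].
have tE f : [/\ swap_entries j f p = f p, swap_entries j f i = f j
    & swap_entries j f j = f i].
  split; first by rewrite swap_entriesD ?pj // eq_sym.
    by rewrite -[in LHS]pj swap_entriesL.
  by rewrite swap_entriesR pj.
apply: lfun_tab_eq => f fP; rewrite !comp_lfunE.
apply: (@sorting_operators_braid _ _ _ (@above n) tab (is_sdt la)
  (fun g : {ffun 'I_n -> domino n} => g p) (fun g : {ffun 'I_n -> domino n} => g i)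
  (fun g : {ffun 'I_n -> domino n} => g j)
  (swap_entries i) (swap_entries j)) fP.
- by move=> d2 d1 d3; exact: above_trans.
- exact: above_irr.
- exact: linear0.
- exact: linear0.
- exact: linearN.
- exact: linearN.
- by move=> g gP; exact: sdt_op_pos.
- by move=> g gP; rewrite sdt_op_pos // pj.
- by move=> g gP; exact: swap_entries_sdt.
- by move=> g gP ab; apply: swap_entries_sdt; rewrite ?pj.
- exact: sE.
- exact: tE.
- move=> g; apply/ffunP => k.
  (* The six values of the exchanges at [p], [i], [j] are bundled into one rewrite rule. *)
  have E h := (let: And3 a b c := sE h in (a, b, c), let: And3 a b c := tE h in (a, b, c)).
  have [->|kp] := eqVneq k p; first by rewrite !E.
  have [->|ki] := eqVneq k i; first by rewrite !E.
  have [->|kj] := eqVneq k j; first by rewrite !E.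
  by rewrite !swap_entriesD ?pj // eq_sym.
Qed.

Lemma sdt_ops : hecke_ops (@sdt_op K n la).
Proof.
have comm i j : (i.+1 < j)%N -> (op i \o op j)%VF = (op j \o op i)%VF.
  have [i0|i0] := posnP i; last exact: sdt_op_commute_pos.
  have [j2 _|j2 ij] := eqVneq (j : nat) 2%N; first exact: sdt_op_commute_zero_two.
  by apply: sdt_op_commute_zero_far => //; lia.
split=> [i|i j /orP[/comm|/comm]|i j|i j] //.
- exact: sdt_op_quadratic.
- exact: sdt_op_braid3.
- exact: sdt_op_braid4.
Qed.

(** * Height and triangularity *)

Definition height f : nat := (\sum_(k < n) ((f k).2 + k * (f k).1.1))%N.

(** The lower domino moves to the larger weight, and the height grows by the difference of the two
    top rows. *)
Lemma swap_entries_height i f : (0 < i)%N -> above (f i) (f (ord_pred i)) ->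
  (height f < height (swap_entries i f))%N.
Proof.
move=> i0 ab; have pi := ord_predE i0.
have pNi : i != ord_pred i by apply: ord_neq; lia.
(* After reindexing, the dominoes stay in place and the weights are exchanged instead. *)
rewrite /height [X in (_ < X)%N](reindex_inj (@perm_inj _ (tperm (ord_pred i) i))) /=.
under [X in (_ < X)%N]eq_bigr => k _ do rewrite ffunE tpermK.
rewrite (bigD1 (ord_pred i)) // (bigD1 i) //= [X in (_ < X)%N](bigD1 (ord_pred i)) //=.
rewrite [X in (_ < _ + X)%N](bigD1 i) //= tpermL tpermR.
rewrite [X in (_ < _ + (_ + X))%N](eq_bigr (fun k : 'I_n => (f k).2 + k * (f k).1.1)%N).
  by move: ab; rewrite /above -![((i + n).-1 %% n)%N]/(ord_pred i : nat) pi; nia.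
by move=> k /andP[k1 k2]; rewrite tpermD // eq_sym.
Qed.

(** Two vertical dominoes appear, while the second domino rises from row 1 to row 0 at weight 1: a
    net gain of 1. *)
Lemma switch_first_height i f : i = 0%N :> nat -> is_sdt la f -> ~~ (f i).2 ->
  stacked i f -> (height f < height (switch_first f))%N.
Proof.
move=> i0 fP fh st; have [fr fc] := is_sdt_corner la_part fP i0.
have S1 := stacked_ordS i0 fr st; have /and3P[/eqP Sr /eqP Sc Sh] := st.
have SNi : ordS i != i by apply: ord_neq; rewrite S1 i0.
have S1n : (1 %% n)%N = 1%N by move: S1; rewrite /= i0.
rewrite /height (bigD1 i) // (bigD1 (ordS i)) //=.
rewrite [X in (_ < X)%N](bigD1 i) //= [X in (_ < _ + X)%N](bigD1 (ordS i)) //=.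
rewrite [X in (_ < _ + (_ + X))%N](eq_bigr (fun k : 'I_n => (f k).2 + k * (f k).1.1)%N).
  rewrite !ffunE S1 i0 /= S1n; move: fr fc fh Sr Sc Sh.
  by case: (f i) (f (ordS i)) => [[r c] v] [[r' c'] v'] /= -> -> /negPf -> -> -> /negPf ->; lia.
move=> k /andP[/eqP k1 /eqP k2]; rewrite ffunE ifF //; apply/negP => k_lt2.
have [k0|kS] : (k = 0 :> nat \/ k = 1 :> nat)%N by lia.
  by apply: k1; apply: ord_inj; rewrite k0 i0.
by apply: k2; apply: ord_inj; rewrite kS S1.
Qed.

Lemma sdt_s_height i (T U : sdt n la) : i \notin Des T -> sdt_s i T = Some U ->
  (height T < height U)%N.
Proof.
have TP : is_sdt la T by apply/asboolP/(valP T).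
rewrite inE /is_descent /sdt_s; case: ifP => [/eqP i0 fh|/eqP/eqP i0].
  have [fr fc] := is_sdt_corner la_part TP i0.
  rewrite tile_northwest_horizontal //; case: ifP => // st.
  by case: insubP => // V _ VE [<-]; rewrite VE; apply: switch_first_height st.
rewrite -lt0n in i0; rewrite above_cells => nab.
case: insubP => // V _ VE [<-]; rewrite VE; apply: swap_entries_height => //.
apply/negPn/negP => nba; apply: (swap_entries_not_sdt i0 TP nab nba).
by rewrite /swap_entries -VE; apply/asboolP/(valP V).
Qed.

(** A tableau [U] other than [T] contributes to the coefficient at [T] only if [op i] moves [U] to
    [T]; then [U] has smaller height and [v] vanishes there. A move cannot fix [T], as it raises the
    height. *)
Lemma sdt_op_triangular i (v : sdt_space K n la) (T : sdt n la) :
  (forall U : sdt n la, (height U < height T)%N -> (v : {ffun _ -> K^o}) U = 0) ->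
  (op i v : {ffun _ -> K^o}) T
    = if i \in Des T then - (v : {ffun _ -> K^o}) T else 0.
Proof.
move=> v0; rewrite lfunE /= /sdt_op_fun sum_ffunE (bigD1 T) //= big1 => [|U UT].
  rewrite addr0 ffunE /sdt_pi; case: ifP => iD.
    by rewrite !ffunE eqxx scalerN [_ *: _]mulr1.
  case sT: (sdt_s i T) => [V|]; last by rewrite ffunE scaler0.
  rewrite ffunE; case: eqP sT => [<-|_ _]; last by rewrite scaler0.
  by move/(sdt_s_height (negbT iD)); rewrite ltnn.
rewrite ffunE /sdt_pi; case: ifP => iD.
  by rewrite !ffunE eq_sym (negPf UT) oppr0 scaler0.
case sU: (sdt_s i U) => [V|]; last by rewrite ffunE scaler0.
rewrite ffunE; case: eqP sU => [<-|_ _]; last by rewrite scaler0.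
by move/(sdt_s_height (negbT iD)) => /v0 ->; rewrite scale0r.
Qed.

End Relations.

(** The Hecke relations are part of the assertion, since they are what makes the operators a module
    structure. *)
Theorem theorem4p3 (R : realType) (n : nat) (la : seq nat)
    (la_part : is_partition n.*2 la)
    (chB : {additive groth R[i] n -> power_series})
    (chB_simple : forall I : {set 'I_n},
       chB (groth_class (simple_module R[i] I)) = FB I) :
  exists ops : hecke_ops (@sdt_op R[i] n la),
    chB (groth_class (module_of_ops ops)) = G_domino n la.
Proof.
exists (@sdt_ops _ _ _ _ la_part).
rewrite (groth_class_triangular _ (D := @Des n la) (ht := fun T => height T)).
  by rewrite raddf_sum; apply: eq_bigr => T _; exact: chB_simple.
by move=> i v T; exact: (sdt_op_triangular la_part).
Qed.
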